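(* Let $G$ be a graph. If every nonempty independent set $I$ of $G$ satisfies $|I|\leq \delta_G(I)$, then either $G$ has a 2-factor or $G$ is isomorphic to a graph in $\mathcal{G}$.
   Context: All graphs are simple, finite and undirected. $d_G(v)$ denotes the degree of a vertex $v$ in $G$. For a nonempty independent set $I$ of $G$, $\delta_G(I):=\min\{d_G(v)\mid v\in I\}$ is the minimum degree in $G$ of the vertices contained in $I$. A 2-factor of a graph is a spanning 2-regular subgraph. The class $\mathcal{G}$ is defined as follows. For a positive integer $\ell$, let $\mathcal{G}_\ell$ be the set of all graphs obtained as the join of an arbitrary graph of order $\ell-1$ (the graph with no vertices when $\ell=1$) and the union of $\ell$ disjoint copies of the complete graph $K_2$; here the join of two disjoint graphs is their disjoint union together with all edges joining a vertex of one to a vertex of the other. Then $\mathcal{G}:=\bigcup_{\ell=1}^{\infty}\mathcal{G}_\ell$. *)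

(* Defs.v *)
From mathcomp Require Import all_boot.

Set Implicit Arguments.
Unset Strict Implicit.
Unset Printing Implicit Defensive.

(* Simple graphs with vertex set the finite type V (MathComp world).
   The graph on an empty type is allowed. *)
Record sgraph (V : finType) := SGraph {
  adj :> rel V;
  adj_sym : symmetric adj;
  adj_irrefl : irreflexive adj }.

Definition deg (V : finType) (G : sgraph V) (v : V) : nat :=
  #|[set w | G v w]|.

Definition independent (V : finType) (G : sgraph V) (I : {set V}) : Prop :=
  {in I &, forall u v, ~~ G u v}.

(* Every degree is smaller than #|V|, so for nonempty I the default value #|V|
   of the iterated minimum plays no role. *)
Definition min_deg (V : finType) (G : sgraph V) (I : {set V}) : nat :=
  \big[minn/#|V|]_(v in I) deg G v.

Definition regular (V : finType) (k : nat) (G : sgraph V) : Prop :=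
  forall v : V, deg G v = k.

(* Subgraphs sharing the vertex type of G are exactly its spanning subgraphs. *)
Definition spanning_subgraph (V : finType) (F G : sgraph V) : Prop :=
  subrel F G.

Definition has_2factor (V : finType) (G : sgraph V) : Prop :=
  exists F : sgraph V, spanning_subgraph F G /\ regular 2 F.

Definition isomorphic (V W : finType) (G : sgraph V) (H : sgraph W) : Prop :=
  exists f : V -> W, bijective f /\ {mono f : u v / G u v >-> H u v}.

Definition complete_rel (n : nat) : rel 'I_n := fun u v => u != v.

Fact complete_sym n : symmetric (@complete_rel n).
Proof. by move=> u v; rewrite /complete_rel eq_sym. Qed.

Fact complete_irrefl n : irreflexive (@complete_rel n).
Proof. by move=> u; rewrite /complete_rel eqxx. Qed.

Definition complete (n : nat) : sgraph 'I_n :=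
  SGraph (@complete_sym n) (@complete_irrefl n).

(* The vertex (i, v) is the vertex v of the i-th copy of G. *)
Definition copies_rel (l : nat) (V : finType) (G : sgraph V) : rel ('I_l * V) :=
  fun p q => (p.1 == q.1) && G p.2 q.2.

Fact copies_sym l (V : finType) (G : sgraph V) : symmetric (@copies_rel l V G).
Proof. by move=> p q; rewrite /copies_rel eq_sym adj_sym. Qed.

Fact copies_irrefl l (V : finType) (G : sgraph V) :
  irreflexive (@copies_rel l V G).
Proof. by move=> p; rewrite /copies_rel adj_irrefl andbF. Qed.

Definition copies (l : nat) (V : finType) (G : sgraph V) :
    sgraph ('I_l * V)%type :=
  SGraph (@copies_sym l V G) (@copies_irrefl l V G).

Definition join_rel (V W : finType) (G : sgraph V) (H : sgraph W) :
    rel (V + W) :=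
  fun x y => match x, y with
  | inl u, inl v => G u v
  | inr u, inr v => H u v
  | _, _ => true
  end.

Fact join_sym (V W : finType) (G : sgraph V) (H : sgraph W) :
  symmetric (join_rel G H).
Proof. by move=> [u|u] [v|v] //=; rewrite adj_sym. Qed.

Fact join_irrefl (V W : finType) (G : sgraph V) (H : sgraph W) :
  irreflexive (join_rel G H).
Proof. by move=> [u|u] /=; rewrite adj_irrefl. Qed.

Definition join (V W : finType) (G : sgraph V) (H : sgraph W) :
    sgraph (V + W)%type :=
  SGraph (join_sym G H) (join_irrefl G H).

Inductive classG_at (l : nat) : forall V : finType, sgraph V -> Prop :=
  ClassGAt (V : finType) (H : sgraph V) :
    #|V| = l - 1 -> classG_at l (join H (copies l (complete 2))).

Definition classG (V : finType) (G : sgraph V) : Prop :=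
  exists l : nat, 0 < l /\ classG_at l G.

(* Main.v *)
Require Import Defs.
From mathcomp Require Import all_boot zify.
From Stdlib Require Import Classical_Prop.

Set Implicit Arguments.
Unset Strict Implicit.
Unset Printing Implicit Defensive.

(** Why the theorem holds. Write y+ for the successor of y in an orientation of
    a graph of maximum degree two whose components are directed paths and
    directed cycles. Let F be a subgraph of G with all degrees at most two and
    with as many edges as possible, and assume that it is not a 2-factor; a
    vertex of F-degree less than two is called deficient. Two deficient
    vertices that are adjacent in G but not in F contradict maximality
    ([deficient_nonadjacent]). If x is deficient, xy is an edge of G outside F
    and yt an edge of F, then F + xy - yt is as large as F and its deficiency
    has moved from x to t ([slide_step]). All exchange arguments below compose
    slides along alternating trails.

    A deficient edge. Choose F and an end x of a path of F such that the path is
    as short as possible, with F-neighbour p of x, if any. The G-neighbours of x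
    other than p lie outside the path, and x together with their successors is
    independent, because an edge between two of these vertices yields a trail
    that augments F or moves the deficiency from x to p, which shortens the
    path. If the path is a single vertex, this independent set has d(x) + 1
    elements; if it has at least three vertices, the set has d(x) elements and
    the other end of the path can be added. Both contradict the hypothesis on
    G at x, so the path is an edge xx' ([path_is_edge], [deficient_edge]).

    The structure around it. Comparing with the hypothesis on G again, x and x'
    have the same other neighbours S ([other_nbrs_sub]), and the set I consisting
    of x and all y+ with y in S is independent of the largest size allowed,
    |S| + 1 = d(x). Hence every vertex outside I has a neighbour in I. Take a
    vertex w outside S, I and {x, x'} that is adjacent to y+ by an edge outside
    F. Then the successor of w has the same property ([far_succ]); confronting
    w and its two successors with the set obtained from I by reversing the
    orientation gives an augmenting trail, so there is no such w ([far_empty]).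
    Therefore w is y++ for some y in S, and the neighbours of y+ lie in S or
    equal y++. As y+ has degree at least |I| = |S| + 1, all these are neighbours
    ([nbrs_succ]); reversing the orientation gives the same for y++
    ([nbrs_succ2]). So G is the join of G[S] and the edges xx' and y+y++, of
    which there are |S| + 1 ([classG_recognition]). *)

Lemma exists_minimizer (T : Type) (P : T -> Prop) (m : T -> nat) :
  (exists t, P t) -> exists2 t, P t & forall s, P s -> m t <= m s.
Proof.
move=> [t Pt]; have [n le_n] := ubnP (m t).
elim: n t Pt le_n => // n IHn t Pt le_n.
case: (classic (exists2 s, P s & m s < m t)) => [[s Ps lt_st]|no_s].
  by apply: (IHn s Ps); lia.
exists t => // s Ps; rewrite leqNgt; apply/negP => lt_st.
by apply: no_s; exists s.
Qed.

(** * Adding and removing edges *)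

Section EdgeSurgery.
Variable V : finType.
Implicit Types (F G : sgraph V) (u v w x y t : V).

Definition joins u v a b := (a == u) && (b == v) || (a == v) && (b == u).

Lemma joinsC u v a b : joins u v a b = joins u v b a.
Proof. by rewrite /joins orbC [X in X || _]andbC [X in _ || X]andbC. Qed.

Lemma negb_joins u v a b :
  (a != u) || (b != v) -> (a != v) || (b != u) -> ~~ joins u v a b.
Proof. by rewrite /joins negb_or !negb_and => -> ->. Qed.

Definition add_rel F u v : rel V :=
  fun a b => F a b || (a != b) && joins u v a b.

Fact add_sym F u v : symmetric (add_rel F u v).
Proof. by move=> a b; rewrite /add_rel adj_sym eq_sym joinsC. Qed.

Fact add_irrefl F u v : irreflexive (add_rel F u v).
Proof. by move=> a; rewrite /add_rel adj_irrefl eqxx. Qed.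

Definition add_edge F u v : sgraph V :=
  SGraph (add_sym F u v) (add_irrefl F u v).

Definition remove_rel F u v : rel V :=
  fun a b => F a b && ~~ joins u v a b.

Fact remove_sym F u v : symmetric (remove_rel F u v).
Proof. by move=> a b; rewrite /remove_rel adj_sym joinsC. Qed.

Fact remove_irrefl F u v : irreflexive (remove_rel F u v).
Proof. by move=> a; rewrite /remove_rel adj_irrefl. Qed.

Definition remove_edge F u v : sgraph V :=
  SGraph (remove_sym F u v) (remove_irrefl F u v).

Lemma adj_neq F u v : F u v -> u != v.
Proof. by apply: contraTneq => ->; rewrite adj_irrefl. Qed.

Lemma add_edgeE F u v a b :
  u != v -> add_edge F u v a b = F a b || joins u v a b.
Proof.
move=> neq_uv; rewrite /= /add_rel; case: (eqVneq a b) => //= <-.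
rewrite /joins; case: (eqVneq a u) => [->|_] /=.
  by rewrite (negPf neq_uv).
by rewrite andbC; case: (eqVneq a u) => // ->; rewrite (negPf neq_uv).
Qed.

Lemma eq_deg F G : F =2 G -> deg F =1 deg G.
Proof. by move=> eqFG v; apply: eq_card => w; rewrite !inE eqFG. Qed.

Lemma deg_add F u v w :
  u != v -> ~~ F u v ->
  deg (add_edge F u v) w = deg F w + (w == u) + (w == v).
Proof.
move=> neq_uv nFuv.
case: (eqVneq w u) => [->|wu].
  rewrite (negPf neq_uv) addn0 addn1 /deg.
  have ->: [set z | add_edge F u v u z] = v |: [set z | F u z].
    apply/setP => z; rewrite inE add_edgeE // !inE /joins eqxx /=.
    by rewrite (negPf neq_uv) /= orbF orbC.
  by rewrite cardsU1 inE nFuv.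
case: (eqVneq w v) => [->|wv].
  rewrite addn0 addn1 /deg.
  have ->: [set z | add_edge F u v v z] = u |: [set z | F v z].
    apply/setP => z; rewrite inE add_edgeE // !inE /joins eqxx /=.
    by rewrite eq_sym (negPf neq_uv) /= orbC.
  by rewrite cardsU1 inE adj_sym nFuv.
rewrite !addn0; apply: eq_card => z; rewrite !inE add_edgeE // /joins.
by rewrite (negPf wu) (negPf wv) orbF.
Qed.

Lemma deg_remove F u v w :
  F u v -> deg (remove_edge F u v) w + (w == u) + (w == v) = deg F w.
Proof.
move=> Fuv; have neq_uv := adj_neq Fuv.
rewrite -deg_add //=; last by rewrite /remove_rel /joins !eqxx andbF.
apply: eq_deg => a b; rewrite add_edgeE //= /remove_rel.
case: (boolP (joins u v a b)) => [/orP[]/andP[/eqP-> /eqP->]|_].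
- by rewrite Fuv orbT.
- by rewrite adj_sym Fuv orbT.
by rewrite andbT orbF.
Qed.

(** One step along an alternating trail, with [F y t]: [x] gains an edge and [t]
    loses one. *)
Definition slide F x y t := add_edge (remove_edge F y t) x y.

Lemma slideE F x y t a b :
  x != y ->
  slide F x y t a b = F a b && ~~ joins y t a b || joins x y a b.
Proof. by move=> xy; rewrite /slide add_edgeE. Qed.

Lemma slide_keeps F x y t a b :
  x != y -> F a b -> ~~ joins y t a b -> slide F x y t a b.
Proof. by move=> xy Fab nj; rewrite slideE // Fab nj. Qed.

Lemma slide_avoids F x y t a b :
  x != y -> ~~ F a b -> ~~ joins x y a b -> ~~ slide F x y t a b.
Proof. by move=> xy nFab nj; rewrite slideE // (negPf nFab) (negPf nj). Qed.

Lemma deg_slide F x y t w :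
  x != y -> ~~ F x y -> F y t ->
  deg (slide F x y t) w + (w == t) = deg F w + (w == x).
Proof.
move=> xy nFxy Fyt.
rewrite deg_add //; last by rewrite /= /remove_rel (negPf nFxy).
by rewrite -(deg_remove w Fyt); lia.
Qed.

Lemma deg_slide_le F x y t w :
  x != y -> ~~ F x y -> F y t -> w != x -> deg (slide F x y t) w <= deg F w.
Proof.
by move=> xy nFxy Fyt /negPf wx; have := deg_slide w xy nFxy Fyt; rewrite wx; lia.
Qed.

Lemma deg_slide_end F x y t :
  x != y -> ~~ F x y -> F y t -> t != x -> deg (slide F x y t) t < deg F t.
Proof.
move=> xy nFxy Fyt /negPf tx; have := deg_slide t xy nFxy Fyt.
by rewrite tx eqxx; lia.
Qed.

Lemma deg_slide_start F x y t :
  x != y -> ~~ F x y -> F y t -> deg (slide F x y t) x <= (deg F x).+1.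
Proof.
move=> xy nFxy Fyt; have := deg_slide x xy nFxy Fyt.
by rewrite eqxx addn1 => <-; rewrite leq_addr.
Qed.

End EdgeSurgery.

(** * Orientations of graphs with maximum degree at most two *)

Section Orientation.
Variable V : finType.
Implicit Types (F : sgraph V) (D : rel V) (u v w x y : V).

Record orients D F : Prop := Orients {
  orientE : forall a b, F a b = D a b || D b a;
  orient_asym : forall a b, D a b -> ~~ D b a;
  out_inj : forall a b c, D a b -> D a c -> b = c;
  in_inj : forall a b c, D a c -> D b c -> a = b }.

Arguments orient_asym {D F} _ {a b} _.
Arguments out_inj {D F} _ {a b c} _ _.
Arguments in_inj {D F} _ {a b c} _ _.

Definition reverse D : rel V := fun a b => D b a.
Definition source D u := forall a, ~~ D a u.
Definition sink D u := forall a, ~~ D u a.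

Lemma orients_reverse D F : orients D F -> orients (reverse D) F.
Proof.
move=> [E A O I]; split; rewrite /reverse.
- by move=> a b; rewrite E orbC.
- by move=> a b; apply: A.
- by move=> a b c; apply: I.
by move=> a b c; apply: O.
Qed.

Lemma orient_adj D F a b : orients D F -> D a b -> F a b.
Proof. by move=> oD Dab; rewrite (orientE oD) Dab. Qed.

Lemma orient_adjV D F a b : orients D F -> D a b -> F b a.
Proof. by move=> oD Dab; rewrite (orientE oD) Dab orbT. Qed.

Lemma source_or_not D u : source D u \/ exists a, D a u.
Proof.
case: (pickP (D^~ u)) => [a Dau|no]; [by right; exists a | left => a].
by rewrite no.
Qed.

Lemma sink_or_not D u : sink D u \/ exists a, D u a.
Proof. exact: (source_or_not (reverse D) u). Qed.

(** The successor of [y], or [y] itself at a sink. *)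
Definition nxt D y := odflt y [pick t | D y t].

Lemma nxtP D y : ~ sink D y -> D y (nxt D y).
Proof.
rewrite /nxt; case: pickP => [t //|no] nsnk; case: nsnk => t.
by rewrite no.
Qed.

Lemma card_nxt D F (S : {set V}) : orients D F ->
  {in S, forall y, ~ sink D y} -> #|nxt D @: S| = #|S|.
Proof.
move=> oD nsnk; apply: card_in_imset => y z yS zS /= eq_nxt.
apply: (in_inj oD (nxtP (nsnk y yS))); rewrite eq_nxt.
exact: nxtP (nsnk z zS).
Qed.

Lemma deg_source D F u : orients D F -> source D u -> deg F u <= 1.
Proof.
move=> oD src; apply/card_le1_eqP => a b; rewrite !inE !(orientE oD).
by rewrite !(negPf (src _)) !orbF => Da Db; apply: (out_inj oD Db Da).
Qed.

Lemma deg_sink D F u : orients D F -> sink D u -> deg F u <= 1.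
Proof. by move/orients_reverse/deg_source; apply. Qed.

Lemma source_or_sink D F u : orients D F -> deg F u < 2 ->
  source D u \/ sink D u.
Proof.
move=> oD; rewrite ltnNge => /negP degu.
case: (source_or_not D u) => [|[a Dau]]; first by left.
case: (sink_or_not D u) => [|[b Dub]]; first by right.
case: degu; rewrite /deg.
have neq_ab: a != b.
  by apply: contraTneq Dau => ->; apply: (orient_asym oD).
have <-: #|[set a; b]| = 2 by rewrite cards2 neq_ab.
apply/subset_leq_card/subsetP => c; rewrite !inE => /orP[]/eqP->.
  exact: orient_adjV Dau.
exact: orient_adj Dub.
Qed.

Lemma connect_last D u a :
  connect D u a -> a = u \/ exists2 c, connect D u c & D c a.
Proof.
case/connectP => p; case/lastP: p => [|p c] /=; first by left.
rewrite rcons_path last_rcons => /andP[pth Dlc] ->; right.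
by exists (last u p) => //; apply/connectP; exists p.
Qed.

Lemma connect_closed D (B : {set V}) u v :
  (forall a b, D a b -> a \in B -> b \in B) ->
  connect D u v -> u \in B -> v \in B.
Proof.
move=> clB /connectP[q]; elim: q u => [|a q IHq] u /= => [_ -> //|].
by case/andP => Dua pth ev /(clB _ _ Dua); apply: IHq.
Qed.

Lemma connect_source D u v : source D v -> connect D u v -> v = u.
Proof.
by move=> src /connect_last[//|[c _ Dcv]]; rewrite (negPf (src c)) in Dcv.
Qed.

(** The vertices reachable from a source are a whole component: a vertex other
    than the source is reached through its only incoming arc. *)
Lemma connect_pred D F u a b : orients D F -> source D u ->
  D a b -> connect D u b -> connect D u a.
Proof.
move=> oD src Dab /connect_last[eb|[c uc Dcb]].
  by rewrite eb (negPf (src a)) in Dab.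
by rewrite (in_inj oD Dab Dcb).
Qed.

Lemma connect_succ D u a b : D a b -> connect D u a -> connect D u b.
Proof. by move=> /connect1 Dab ua; apply: connect_trans Dab. Qed.

Lemma connect_adj D F u a b : orients D F -> source D u ->
  F a b -> connect D u a -> connect D u b.
Proof.
move=> oD src; rewrite (orientE oD) => /orP[]; first exact: connect_succ.
exact: (connect_pred oD src).
Qed.

(** The vertices reachable from [u] form a component, and reversing the arcs of
    one component leaves the other components alone. *)
Lemma flip_path D F u : orients D F -> source D u ->
  exists2 D', orients D' F & sink D' u /\
    (forall v, v != u -> source D v -> source D' v).
Proof.
move=> oD src; pose R := connect D u.
have RD a b : D a b -> R a = R b.
  move=> Dab; apply/idP/idP; first exact: connect_succ.
  exact: (connect_pred oD src Dab).
exists (fun a b => if R a then D b a else D a b); last split.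
- split.
  + move=> a b; rewrite (orientE oD).
    case: (boolP (D a b)) => [/RD->|nab]; first by case: (R b); rewrite ?orbT.
    case: (boolP (D b a)) => [/RD->|nba]; first by case: (R a).
    by rewrite !if_same.
  + move=> a b; have A := orient_asym oD.
    case: ifP => Ra Dab; first by rewrite (RD _ _ Dab) Ra A.
    by rewrite -(RD _ _ Dab) Ra A.
  + by move=> a b c; case: (R a) => /=; [apply: (in_inj oD) | apply: (out_inj oD)].
  move=> a b c; case: ifP => Ra; case: ifP => Rb Dac Dbc.
  + exact: (out_inj oD Dac Dbc).
  + by move: Ra Rb; rewrite -(RD _ _ Dac) (RD _ _ Dbc) => ->.
  + by move: Ra Rb; rewrite -(RD _ _ Dbc) (RD _ _ Dac) => ->.
  exact: (in_inj oD Dac Dbc).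
- by move=> a; rewrite /R connect0.
move=> v neq_vu srcv a; case: ifP => // Ra; apply/negP => Dva.
have Rv: R v by rewrite (RD _ _ Dva).
by rewrite (connect_source srcv Rv) eqxx in neq_vu.
Qed.

(** This makes room for an arc from [u] to [v]. If both vertices are sources, or
    both sinks, they are ends of different paths, and only one of these is turned. *)
Lemma align_ends D F u v : orients D F -> u != v ->
  source D u \/ sink D u -> source D v \/ sink D v ->
  exists2 D', orients D' F & sink D' u /\ source D' v.
Proof.
move=> oD uv [su|su] [sv|sv].
- have [D' oD' [su' sv']] := flip_path oD su.
  by exists D' => //; split=> //; apply: sv' => //; rewrite eq_sym.
- by exists (reverse D); first exact: orients_reverse.
- by exists D.
have [D' oD' [sv' su']] := flip_path (orients_reverse oD) sv.
by exists (reverse D'); [exact: orients_reverse | split=> //; exact: su'].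
Qed.

(** Induction on the number of edges: after an edge is removed, its ends have
    degree at most one, so each is a source or a sink of an orientation of the
    rest, and they can be aligned before the edge comes back as an arc. *)
Lemma orientation_exists F : (forall v, deg F v <= 2) -> exists D, orients D F.
Proof.
have [n] := ubnP (\sum_v deg F v); elim: n F => // n IHn F le_n degF.
case: (pickP (fun e => F e.1 e.2)) => [[u v] /= Fuv|no]; last first.
  by exists (fun _ _ => false); split=> // a b; apply: (no (a, b)).
have uv := adj_neq Fuv; pose F' := remove_edge F u v.
have degF' w : deg F' w + (w == u) + (w == v) = deg F w by apply: deg_remove.
have degu: deg F' u < 2.
  by have := degF u; rewrite -degF' eqxx (negPf uv); lia.
have degv: deg F' v < 2.
  by have := degF v; rewrite -degF' eqxx eq_sym (negPf uv); lia.
have [||D oD] := IHn F'.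
- move: le_n; rewrite (bigD1 u) // [X in _ -> X < _](bigD1 u) //= -(degF' u) eqxx.
  have: \sum_(i | i != u) deg F' i <= \sum_(i | i != u) deg F i.
    by apply: leq_sum => w _; rewrite -degF'; lia.
  by lia.
- by move=> w; apply: leq_trans (degF w); rewrite -degF'; lia.
have [D' [E A O I] [su sv]] := align_ends oD uv (source_or_sink oD degu)
  (source_or_sink oD degv).
have nvu: D' v u = false.
  apply/negbTE; have := E v u.
  by rewrite /= /remove_rel /joins !eqxx orbT andbF; case: (D' v u).
exists (fun a b => D' a b || (a == u) && (b == v)); split.
- move=> a b; have := E a b; rewrite /= /remove_rel.
  rewrite orbACA => <-; rewrite -/(joins u v a b).
  have ->: (b == u) && (a == v) = (a == v) && (b == u) by rewrite andbC.
  rewrite -/(joins u v a b).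
  case: (boolP (joins u v a b)) => [/orP[]/andP[/eqP-> /eqP->]|_].
  + by rewrite Fuv orbT.
  + by rewrite adj_sym Fuv orbT.
  by rewrite andbT orbF.
- move=> a b /orP[Dab|/andP[/eqP-> /eqP->]].
    rewrite negb_or A //=; apply/negP => /andP[/eqP eb /eqP ea].
    by rewrite ea eb nvu in Dab.
  by rewrite nvu eq_sym (negPf uv).
- move=> a b c /orP[Dab|/andP[/eqP-> /eqP->]] /orP[Dac|/andP[/eqP ea /eqP ec]].
  + exact: (O _ _ _ Dab Dac).
  + by rewrite ea (negPf (su _)) in Dab.
  + by rewrite (negPf (su _)) in Dac.
  by rewrite ec.
move=> a b c /orP[Dac|/andP[/eqP-> /eqP->]] /orP[Dbc|/andP[/eqP eb /eqP ec]].
- exact: (I _ _ _ Dac Dbc).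
- by rewrite ec (negPf (sv _)) in Dac.
- by rewrite (negPf (sv _)) in Dbc.
by rewrite eb.
Qed.

End Orientation.

(** * Maximum simple 2-matchings *)

Section TwoMatching.
Variables (V : finType) (G : sgraph V).
Implicit Types (F : sgraph V) (D : rel V) (a b s t u v w x y z p : V).

Definition two_matching F : Prop := subrel F G /\ forall v, deg F v <= 2.

(** The sum of the degrees is twice the number of edges. *)
Definition optimal F : Prop :=
  two_matching F /\
  forall F', two_matching F' -> \sum_v deg F' v <= \sum_v deg F v.

Definition deficient F v := deg F v < 2.

Lemma optimal_exists : exists F, optimal F.
Proof.
have [|F mF minF] := @exists_minimizer _ two_matching
    (fun F => 2 * #|V| - \sum_v deg F v).
  have e0: irreflexive (fun _ _ : V => false) by [].
  have s0: symmetric (fun _ _ : V => false) by [].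
  exists (SGraph s0 e0); split=> // v.
  by rewrite /deg /= (_ : [set w | false] = set0) ?cards0.
exists F; split=> // F' mF'; have := minF _ mF'.
have ub F1 : two_matching F1 -> \sum_v deg F1 v <= 2 * #|V|.
  move=> [_ le2]; rewrite mulnC -sum_nat_const.
  by apply: leq_sum => v _; apply: le2.
by have := ub _ mF; have := ub _ mF'; lia.
Qed.

Lemma deficient_exists F : optimal F -> ~ has_2factor G ->
  exists v, deficient F v.
Proof.
move=> [[subFG le2] _] no2; apply: NNPP => nodef; apply: no2; exists F.
split=> // v; apply/eqP; rewrite eqn_leq le2 leqNgt; apply/negP => defv.
by apply: nodef; exists v.
Qed.

Lemma sum_indicator (v : V) : \sum_(w : V) (w == v : nat) = 1.
Proof. by rewrite (bigD1 v) //= eqxx big1 // => w /negPf->. Qed.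

(** Otherwise [uv] could be added to [F]. *)
Lemma deficient_nonadjacent F u v : optimal F ->
  deficient F u -> deficient F v -> G u v -> ~~ F u v -> False.
Proof.
move=> [[subFG le2] maxF] du dv Guv nFuv; have uv := adj_neq Guv.
have degF' w := deg_add w uv nFuv.
have := maxF (add_edge F u v).
rewrite (eq_bigr _ (fun w _ => degF' w)) !big_split /= !sum_indicator.
suff mF': two_matching (add_edge F u v) by move/(_ mF'); lia.
split=> [a b|w].
  rewrite add_edgeE // => /orP[/subFG //|/orP[]/andP[/eqP-> /eqP->]] //.
  by rewrite adj_sym.
rewrite degF'; case: (eqVneq w u) => [->|_].
  by rewrite (negPf uv); move: du; rewrite /deficient; lia.
by case: eqVneq => [->|_]; have := le2 w; move: dv; rewrite /deficient; lia.
Qed.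

Section Slide.
Variables (F : sgraph V) (x y t : V).
Hypotheses (optF : optimal F) (dx : deficient F x).
Hypotheses (Gxy : G x y) (nFxy : ~~ F x y) (Fyt : F y t).

Let xy : x != y := adj_neq Gxy.
Let degF1 w := deg_slide w xy nFxy Fyt.

Lemma slide_end_neq : t != x.
Proof. by apply: contraNneq nFxy => <-; rewrite adj_sym. Qed.

Lemma slide_optimal : optimal (slide F x y t).
Proof.
have [[subFG le2] maxF] := optF; split; first split.
- move=> a b; rewrite slideE // => /orP[/andP[/subFG]|] //.
  by case/orP=> /andP[/eqP-> /eqP->] //; rewrite adj_sym.
- move=> w; have := degF1 w; case: (eqVneq w x) => [->|_].
    by move: dx; rewrite /deficient; lia.
  by have := le2 w; lia.
move=> F' /maxF; suff ->: \sum_v deg (slide F x y t) v = \sum_v deg F v by [].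
have: \sum_v (deg (slide F x y t) v + (v == t)) = \sum_v (deg F v + (v == x)).
  by apply: eq_bigr => w _.
by rewrite !big_split /= !sum_indicator; lia.
Qed.

Lemma slide_deficient_end : deficient (slide F x y t) t.
Proof.
have [[_ le2] _] := optF; have := degF1 t; have := le2 t.
by rewrite eqxx (negPf slide_end_neq) /deficient; lia.
Qed.

Lemma slide_deficient v : v != x -> deficient F v -> deficient (slide F x y t) v.
Proof. by move=> /negPf vx; have := degF1 v; rewrite vx /deficient; lia. Qed.

Lemma slide_step : [/\ optimal (slide F x y t), deficient (slide F x y t) t &
  forall v, v != x -> deficient F v -> deficient (slide F x y t) v].
Proof.
split; [exact: slide_optimal | exact: slide_deficient_end | exact: slide_deficient].
Qed.

End Slide.

End TwoMatching.

Ltac apart :=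
  solve [ assumption | rewrite eq_sym; assumption
        | eapply adj_neq; eassumption
        | rewrite eq_sym; eapply adj_neq; eassumption ].

Ltac clash :=
  subst; match goal with
  | H : is_true (?a != ?a) |- _ => by rewrite eqxx in H
  | H : is_true (adj _ ?a ?a) |- _ => by rewrite adj_irrefl in H
  | H1 : is_true (~~ ?b), H2 : is_true ?b |- _ => by rewrite H2 in H1
  | H1 : is_true (~~ adj ?F ?a ?b), H2 : is_true (adj ?F ?b ?a) |- _ =>
      by rewrite adj_sym H2 in H1
  end.

(* Shows that two pairs of vertices are not the same edge, from inequalities
   between vertices and from edges and non-edges in the context. *)
Ltac off_edge :=
  solve [ apply: negb_joins; apply/orP; solve [left; apart | right; apart]
        | rewrite /joins; apply/negP => /orP[]/andP[/eqP ? /eqP ?]; clash ].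

Section Swaps.
Variables (V : finType) (G : sgraph V).

(** Slides along the alternating trail [x y t x p]: the vertex [x] is put between
    [y] and [t] and gives up its old edge to [p]. *)
Lemma triangle_swap (F : sgraph V) x p y t :
  optimal G F -> deficient F x -> F x p -> G x y -> ~~ F x y -> F y t ->
  G x t -> ~~ F x t ->
  exists2 F', optimal G F' /\ deg F' p < deg F p &
    forall a b, F' a b -> a \notin [:: x; y; t] -> F a b && ~~ joins x p a b.
Proof.
move=> optF dx Fxp Gxy nFxy Fyt Gxt nFxt.
have xy := adj_neq Gxy; have xt := adj_neq Gxt.
have tx : t != x by rewrite eq_sym.
have [o1 d1 _] := slide_step optF dx Gxy nFxy Fyt.
have Gtx : G t x by rewrite adj_sym.
have nF1 : ~~ slide F x y t t x.
  by apply: slide_avoids => //; [rewrite adj_sym | off_edge].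
have F1 : slide F x y t x p by apply: slide_keeps => //; off_edge.
have [o2 _ _] := slide_step o1 d1 Gtx nF1 F1.
exists (slide (slide F x y t) t x p).
  split=> //; have px : p != x by rewrite eq_sym (adj_neq Fxp).
  have pt : p != t by apply: contraNneq nFxt => <-.
  apply: leq_trans (deg_slide_end tx nF1 F1 pt) _.
  exact: deg_slide_le.
move=> a b; rewrite !slideE // !inE !negb_or => Fab /and3P[ax ay at'].
move: Fab; rewrite /joins (negPf ax) (negPf ay) (negPf at') /= !orbF -andbA.
by case/and3P=> -> _ ->.
Qed.

(** Slides along the alternating trail [x y t s z x p]: the edges [yt] and [zs]
    are replaced by [ts] and the path [y x z], and [x] gives up [p]. *)
Lemma pentagon_swap (F : sgraph V) x p y t z s :
  optimal G F -> deficient F x -> F x p -> G x y -> ~~ F x y -> F y t ->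
  G x z -> ~~ F x z -> F z s -> G t s -> ~~ F t s ->
  y != z -> t != z -> s != y -> p != t ->
  exists2 F', optimal G F' /\ deg F' p < deg F p &
    forall a b, F' a b -> a \notin [:: x; y; t; z; s] ->
      F a b && ~~ joins x p a b.
Proof.
move=> optF dx Fxp Gxy nFxy Fyt Gxz nFxz Fzs Gts nFts yz tz sy pt.
have xy := adj_neq Gxy; have xz := adj_neq Gxz; have ts := adj_neq Gts.
have tx := slide_end_neq nFxy Fyt; have sx := slide_end_neq nFxz Fzs.
have zx : z != x by rewrite eq_sym.
have [o1 d1 _] := slide_step optF dx Gxy nFxy Fyt.
have nF1 : ~~ slide F x y t t s by apply: slide_avoids => //; off_edge.
have F1 : slide F x y t s z.
  by apply: slide_keeps => //; [rewrite adj_sym | off_edge].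
have [o2 d2 _] := slide_step o1 d1 Gts nF1 F1.
set F2 := slide _ t s z in o2 d2.
have Gzx : G z x by rewrite adj_sym.
have nF2 : ~~ F2 z x.
  apply: slide_avoids => //; last by off_edge.
  by apply: slide_avoids => //; [rewrite adj_sym | off_edge].
have F2xp : F2 x p.
  by do 2![apply: slide_keeps => //; last by off_edge].
have [o3 _ _] := slide_step o2 d2 Gzx nF2 F2xp.
exists (slide F2 z x p).
  split=> //; have px : p != x by rewrite eq_sym (adj_neq Fxp).
  have pz : p != z by apply: contraNneq nFxz => <-.
  apply: leq_trans (deg_slide_end zx nF2 F2xp pz) _.
  apply: leq_trans (deg_slide_le ts nF1 F1 pt) _.
  exact: deg_slide_le.
move=> a b; rewrite !slideE // !inE !negb_or.
move=> Fab /and5P[/negPf ax /negPf ay /negPf at' /negPf az /negPf as'].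
move: Fab; rewrite /joins ax ay at' az as' /= !orbF -!andbA.
by case/and4P=> -> _ _ ->.
Qed.

End Swaps.

(** * Reduction to a deficient path with one edge *)

Section Shrink.
Variables (V : finType) (G : sgraph V).
Implicit Types (F : sgraph V) (D : rel V) (a b s t u v w x y z p : V).

Definition adj_closed F (B : {set V}) : Prop :=
  forall a b, F a b -> a \in B -> b \in B.

Definition reach D x := [set v | connect D x v].

(** The minimum is taken over unions of components rather than over paths, so
    that a competitor [F1] can be used without orienting it. *)
Lemma shortest_deficient_path : ~ has_2factor G ->
  exists F D x, [/\ optimal G F, orients D F, source D x, deficient F x &
    forall F1 p (B : {set V}), optimal G F1 -> deficient F1 p -> p \in B ->
      adj_closed F1 B -> #|reach D x| <= #|B|].
Proof.
move=> no2.
pose good (c : sgraph V * V * {set V}) := let: (F, p, B) := c in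
  [/\ optimal G F, deficient F p, p \in B & adj_closed F B].
have [|[[F x] B] [optF dx xB clB] minB] :=
    @exists_minimizer _ good (fun c => #|c.2|).
  have [F optF] := optimal_exists G.
  have [v dv] := deficient_exists optF no2.
  by exists (F, v, [set: V]); split=> // a b; rewrite !inE.
have [D0 oD0] := orientation_exists optF.1.2.
have [D [oD srcx]] : exists D, orients D F /\ source D x.
  case: (source_or_sink oD0 dx) => [srcx|snkx]; first by exists D0.
  by exists (reverse D0); split; first exact: orients_reverse.
exists F, D, x; split=> // F1 p B1 optF1 dp pB1 clB1.
apply: leq_trans (minB (F1, p, B1) _) => //.
apply/subset_leq_card/subsetP => v; rewrite inE => xv.
apply: connect_closed xv xB => a b Dab; apply: clB.
exact: (orient_adj oD Dab).
Qed.

Section MinimalPath.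
Variables (F : sgraph V) (D : rel V) (x : V).
Hypotheses (optF : optimal G F) (oD : orients D F) (srcx : source D x).
Hypothesis dx : deficient F x.
Hypothesis minA : forall F1 p (B : {set V}),
  optimal G F1 -> deficient F1 p -> p \in B -> adj_closed F1 B ->
  #|reach D x| <= #|B|.

Let A := reach D x.
Let S := [set y | G x y && ~~ F x y].

Lemma x_in_reach : x \in A.
Proof. by rewrite inE connect0. Qed.

Lemma reach_closed : adj_closed F A.
Proof. by move=> a b Fab; rewrite !inE; apply: connect_adj Fab. Qed.

Lemma new_neighbour_saturated y : y \in S -> ~~ deficient F y.
Proof.
rewrite inE => /andP[Gxy nFxy]; apply/negP => dy.
exact: (deficient_nonadjacent optF dx dy).
Qed.

(** If [y] were on the path, [F + xy - yt] with [t] the successor of [y] would have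
    the part of the path from [t] on as a shorter path. *)
Lemma new_neighbour_outside y : y \in S -> y \notin A.
Proof.
move=> yS; apply/negP; rewrite inE => xy.
have ndy := new_neighbour_saturated yS.
move: yS; rewrite inE => /andP[Gxy nFxy].
have [snky|[t Dyt]] := sink_or_not D y.
  by case/negP: ndy; apply: deg_sink oD snky.
have Fyt := orient_adj oD Dyt; have neq_tx := slide_end_neq nFxy Fyt.
have predB a b : D a b -> b \in reach D t -> a = y \/ a \in reach D t.
  rewrite !inE => Dab /connect_last[eb|[c tc Dcb]].
    by left; rewrite eb in Dab; apply: (in_inj oD Dab Dyt).
  by right; rewrite (in_inj oD Dab Dcb).
have nxB : x \notin reach D t.
  by rewrite inE; apply: contraNN neq_tx => /(connect_source srcx) ->.
have nyB : y \notin reach D t.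
  apply/negP => yB.
  have: y \in ~: reach D t.
    apply: connect_closed xy _; last by rewrite inE.
    move=> a b Dab; rewrite !in_setC; apply: contraNN => bB.
    by case: (predB _ _ Dab bB) => [->|].
  by rewrite in_setC yB.
have: A \subset reach D t.
  suff ltA: #|A| <= #|reach D t|.
    suff subA: reach D t \subset A.
      by have /eqP-> : reach D t == A by rewrite eqEcard subA.
    apply/subsetP => v; rewrite !inE; apply: connect_trans.
    exact: connect_succ Dyt xy.
  have [optF1 dt _] := slide_step optF dx Gxy nFxy Fyt.
  apply: (minA optF1 dt); first by rewrite inE connect0.
  move=> a b; rewrite slideE ?(adj_neq Gxy) //.
  case/orP => [/andP[Fab nyt] aB|/orP[]/andP[/eqP-> _] aB]; first last.
  - by rewrite aB in nyB.
  - by rewrite aB in nxB.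
  move: Fab; rewrite (orientE oD) => /orP[Dab|Dba].
    by move: aB; rewrite !inE; apply: connect_succ Dab.
  move: aB; rewrite inE => /connect_last[ea|[c tc Dca]].
    move: nyt; rewrite ea in Dba *; rewrite (in_inj oD Dba Dyt).
    by rewrite /joins !eqxx orbT.
  by rewrite (in_inj oD Dba Dca) inE.
by move/subsetP/(_ _ x_in_reach); apply/negP.
Qed.

Hypothesis hG : forall I v, independent G I -> v \in I -> #|I| <= deg G v.

Lemma new_neighbour_succ y : y \in S -> ~ sink D y.
Proof.
move=> /new_neighbour_saturated/negP ndy snky; case: ndy.
exact: deg_sink oD snky.
Qed.

(** In [F'] the path without [x] is still a union of components, and [p] is
    deficient in it. *)
Lemma no_shorter_path F' p : D x p -> optimal G F' -> deg F' p < deg F p ->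
  (forall a b, F' a b -> a \in A -> a != x -> F a b && ~~ joins x p a b) -> False.
Proof.
move=> Dxp optF' degp agree; have Fxp := orient_adj oD Dxp.
have dp : deficient F' p.
  exact: leq_trans degp (optF.1.2 p).
have pA : p \in A :\ x.
  by rewrite !inE eq_sym (adj_neq Fxp) connect1.
suff clA : adj_closed F' (A :\ x).
  have := minA optF' dp pA clA.
  by rewrite -/A [#|A|](cardsD1 x) x_in_reach add1n ltnn.
move=> a b Fab; rewrite in_setD1 => /andP[ax aA].
have /andP[{}Fab njoin] := agree _ _ Fab aA ax.
rewrite in_setD1 (reach_closed Fab aA) andbT.
apply: contraNneq njoin => bx; move: Fab; rewrite bx (orientE oD).
rewrite (negPf (srcx a)) /= => Dxa.
by rewrite (out_inj oD Dxa Dxp) /joins !eqxx orbT.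
Qed.

Lemma new_end_outside y t : y \in S -> F y t -> t \notin A.
Proof.
move=> yS Fyt; apply: contraNN (new_neighbour_outside yS).
by apply: reach_closed; rewrite adj_sym.
Qed.

(** Otherwise [x] could be inserted into the edge [yt]. A vertex [x] without
    F-neighbours then becomes saturated; otherwise [x] drops its edge to [p]
    and the path gets shorter. *)
Lemma new_end_nonadjacent y t : y \in S -> F y t -> ~~ G x t.
Proof.
move=> yS Fyt; apply/negP => Gxt.
have yA := new_neighbour_outside yS; have tA := new_end_outside yS Fyt.
have xA := x_in_reach; move: (yS); rewrite inE => /andP[Gxy nFxy].
have nFxt : ~~ F x t.
  by apply: contraNN tA => Fxt; apply: reach_closed Fxt xA.
case: (sink_or_not D x) => [snkx|[p Dxp]].
  have [o1 d1 k1] := slide_step optF dx Gxy nFxy Fyt.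
  have xy := adj_neq Gxy; have yt := adj_neq Fyt; have xt := adj_neq Gxt.
  apply: (deficient_nonadjacent o1 _ d1 Gxt); last first.
    by apply: slide_avoids => //; off_edge.
  have deg0: deg F x = 0.
    apply: eq_card0 => v; rewrite !inE (orientE oD).
    by rewrite (negPf (snkx v)) (negPf (srcx v)).
  by have := deg_slide_start xy nFxy Fyt; rewrite deg0.
have Fxp := orient_adj oD Dxp.
have [F' [optF' degp] agree] := triangle_swap optF dx Fxp Gxy nFxy Fyt Gxt nFxt.
apply: (no_shorter_path Dxp optF' degp) => a b Fab aA ax.
apply: agree => //; rewrite !inE !negb_or ax /=.
by apply/andP; split; [apply: contraNneq yA | apply: contraNneq tA] => <-.
Qed.

Lemma new_end_not_new y t : y \in S -> F y t -> t \notin S.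
Proof.
by move=> yS /(new_end_nonadjacent yS); apply: contraNN; rewrite inE => /andP[].
Qed.

(** Otherwise [yt] and [zs] could be replaced by [ts] and the path [y x z], giving
    [x] two new edges; the two cases are those of [new_end_nonadjacent]. *)
Lemma new_ends_nonadjacent y z t s : y \in S -> z \in S -> y != z ->
  F y t -> F z s -> ~~ F t s -> ~~ G t s.
Proof.
move=> yS zS yz Fyt Fzs nFts; apply/negP => Gts.
have yA := new_neighbour_outside yS; have tA := new_end_outside yS Fyt.
have zA := new_neighbour_outside zS; have sA := new_end_outside zS Fzs.
have tS := new_end_not_new yS Fyt; have sS := new_end_not_new zS Fzs.
have tz : t != z by apply: contraNneq tS => ->.
have sy : s != y by apply: contraNneq sS => ->.
have xA := x_in_reach; move: (yS); rewrite inE => /andP[Gxy nFxy].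
move: (zS); rewrite inE => /andP[Gxz nFxz].
case: (sink_or_not D x) => [snkx|[p Dxp]].
  have [o1 d1 k1] := slide_step optF dx Gxy nFxy Fyt.
  have xy := adj_neq Gxy; have xz := adj_neq Gxz; have ts := adj_neq Gts.
  have tx := slide_end_neq nFxy Fyt; have sx := slide_end_neq nFxz Fzs.
  have deg0: deg F x = 0.
    apply: eq_card0 => v; rewrite !inE (orientE oD).
    by rewrite (negPf (snkx v)) (negPf (srcx v)).
  have dx1: deficient (slide F x y t) x.
    by have := deg_slide_start xy nFxy Fyt; rewrite deg0.
  have nF1 : ~~ slide F x y t x z by apply: slide_avoids => //; off_edge.
  have F1 : slide F x y t z s by apply: slide_keeps => //; off_edge.
  have [o2 d2 k2] := slide_step o1 dx1 Gxz nF1 F1.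
  apply: (deficient_nonadjacent o2 (k2 _ tx d1) d2 Gts).
  apply: slide_avoids => //; last by off_edge.
  by apply: slide_avoids => //; off_edge.
have Fxp := orient_adj oD Dxp.
have pt : p != t by apply: contraNneq tA => <-; apply: reach_closed Fxp xA.
have [F' [optF' degp] agree] :=
  pentagon_swap optF dx Fxp Gxy nFxy Fyt Gxz nFxz Fzs Gts nFts yz tz sy pt.
apply: (no_shorter_path Dxp optF' degp) => a b Fab aA ax.
apply: agree => //; rewrite !inE !negb_or ax /=.
by apply/and4P; split;
  [apply: contraNneq yA | apply: contraNneq tA
  |apply: contraNneq zA | apply: contraNneq sA] => <-.
Qed.

Let I := x |: nxt D @: S.

Lemma shifted_independent : independent G I.
Proof.
have succF y : y \in S -> F y (nxt D y).
  by move=> yS; apply: (orient_adj oD); apply/nxtP/new_neighbour_succ.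
have nxt_pair y z : y \in S -> z \in S -> y != z -> ~~ D (nxt D y) (nxt D z).
  move=> yS zS yz; apply/negP => Dyz.
  have := new_end_not_new yS (succF y yS).
  by rewrite (in_inj oD Dyz (nxtP (new_neighbour_succ zS))) zS.
move=> u v; rewrite !inE.
case/orP => [/eqP->|/imsetP[y yS ->]] /orP[/eqP->|/imsetP[z zS ->]].
- by rewrite adj_irrefl.
- exact: new_end_nonadjacent zS (succF z zS).
- rewrite adj_sym; exact: new_end_nonadjacent yS (succF y yS).
case: (eqVneq y z) => [->|yz]; first by rewrite adj_irrefl.
apply: (new_ends_nonadjacent yS zS yz (succF y yS) (succF z zS)).
by rewrite (orientE oD) negb_or !nxt_pair // eq_sym.
Qed.

Lemma shifted_outside v : v \in nxt D @: S -> v \notin A.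
Proof.
case/imsetP => y yS ->; apply: (new_end_outside yS).
by apply: (orient_adj oD); apply/nxtP/new_neighbour_succ.
Qed.

Lemma card_shifted : #|I| = #|S|.+1.
Proof.
rewrite cardsU1 (card_nxt oD new_neighbour_succ) (_ : x \notin _) //.
by apply: contraL x_in_reach => /shifted_outside.
Qed.

(** Otherwise the successor map would be an injection of the finite set [A]
    into [A] without [x]. *)
Lemma sink_in_reach : exists2 x', x' \in A & sink D x'.
Proof.
apply: NNPP => nosink; have nsnk: {in A, forall v, ~ sink D v}.
  by move=> v vA snkv; apply: nosink; exists v.
suff /subset_leq_card: nxt D @: A \subset A :\ x.
  by rewrite (card_nxt oD nsnk) [#|A|](cardsD1 x) x_in_reach add1n ltnn.
apply/subsetP => _ /imsetP[v vA ->]; have Dv := nxtP (nsnk v vA).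
rewrite in_setD1 (reach_closed (orient_adj oD Dv) vA) andbT.
by apply: contraTneq Dv => ->.
Qed.

(** On one vertex the independent set [I] has [d(x) + 1] elements; on at least
    three vertices it has [d(x)] and the other end of the path can be added. *)
Lemma path_is_edge : exists2 x', D x x' & sink D x'.
Proof.
have [x' x'A snkx'] := sink_in_reach.
have subFG := optF.1.1.
case: (sink_or_not D x) => [snkx|[p Dxp]].
  have := hG shifted_independent (setU11 _ _).
  rewrite card_shifted ltnNge subset_leq_card //.
  apply/subsetP => v; rewrite !inE (orientE oD) => ->.
  by rewrite (negPf (snkx v)) (negPf (srcx v)).
have Fxp := orient_adj oD Dxp.
have Fx v : F x v -> v = p.
  by rewrite (orientE oD) (negPf (srcx v)) orbF => Dxv; apply: (out_inj oD Dxv Dxp).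
exists p => //; case: (sink_or_not D p) => [//|[q Dpq]].
have xx' : x' != x by apply: contraTneq Dxp => <-.
have px' : x' != p by apply: contraTneq Dpq => <-.
have dx' : deficient F x' by apply: deg_sink oD snkx'.
have Gx' v : v \in I -> ~~ G x' v.
  rewrite !inE => /orP[/eqP->|/imsetP[y yS ->]]; apply/negP => Gx'.
    apply: (deficient_nonadjacent optF dx' dx Gx').
    by apply: contraNN px'; rewrite adj_sym => /Fx->.
  move: (yS); rewrite inE => /andP[Gxy nFxy].
  have Dy := nxtP (new_neighbour_succ yS); have Fy := orient_adj oD Dy.
  have tA := new_end_outside yS Fy; have yA := new_neighbour_outside yS.
  have [o1 d1 k1] := slide_step optF dx Gxy nFxy Fy.
  apply: (deficient_nonadjacent o1 (k1 _ xx' dx') d1 Gx').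
  have x'y : x' != y by apply: contraNneq yA => <-.
  apply: slide_avoids; [exact: adj_neq Gxy | | off_edge].
  by apply: contraNN tA => Fx't; apply: reach_closed Fx't x'A.
have indep : independent G (x' |: I).
  move=> u v; rewrite in_setU1 => /orP[/eqP->|uI];
    rewrite in_setU1 => /orP[/eqP->|vI].
  - by rewrite adj_irrefl.
  - exact: Gx'.
  - by rewrite adj_sym; apply: Gx'.
  exact: shifted_independent.
have := hG indep (_ : x \in x' |: I); rewrite !inE eqxx orbT => /(_ isT).
rewrite cardsU1 card_shifted (_ : x' \notin I); last first.
  rewrite !inE negb_or xx' /=; apply: contraL x'A; exact: shifted_outside.
rewrite add1n ltnNge => /negP; case; apply: leq_trans (_ : #|p |: S| <= _).
  apply/subset_leq_card/subsetP => v; rewrite !inE => Gxv; rewrite Gxv /=.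
  by case: (boolP (F x v)) => [/Fx->|]; rewrite ?eqxx // orbT.
by rewrite cardsU1; case: (p \notin S).
Qed.

End MinimalPath.
(** An isolated vertex of [F1] would be a path shorter than the edge [xx']. *)
Lemma deficient_edge :
  (forall I v, independent G I -> v \in I -> #|I| <= deg G v) ->
  ~ has_2factor G -> exists F x x', [/\ optimal G F,
    forall v, F x v = (v == x'), forall v, F x' v = (v == x) &
    forall F1 v, optimal G F1 -> deg F1 v != 0].
Proof.
move=> hG no2.
have [F [D [x [optF oD srcx dx minA]]]] := shortest_deficient_path no2.
have [x' Dxx' snkx'] := path_is_edge optF oD srcx dx minA hG.
exists F, x, x'; split=> //.
- move=> v; rewrite (orientE oD) (negPf (srcx v)) orbF.
  by apply/idP/eqP => [Dxv|->//]; apply: (out_inj oD Dxv Dxx').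
- move=> v; rewrite (orientE oD) (negPf (snkx' v)) /=.
  by apply/idP/eqP => [Dxv|->//]; apply: (in_inj oD Dxv Dxx').
move=> F1 v optF1; apply/eqP => deg0.
have dv : deficient F1 v by rewrite /deficient deg0.
have F1v w : F1 v w = false by have := card0_eq deg0 w; rewrite !inE.
have := minA F1 v [set v] optF1 dv (set11 v).
rewrite cards1 leqNgt => /(_ _)/negP; case.
  by move=> a b; rewrite inE => + /eqP ea; rewrite ea F1v.
have <- : #|[set x; x']| = 2.
  by rewrite cards2 (adj_neq (orient_adj oD Dxx')).
apply/subset_leq_card/subsetP => w; rewrite !inE => /orP[]/eqP->.
  exact: connect0.
exact: connect1.
Qed.

End Shrink.

(** * The structure around a deficient edge *)

Section LonelyEdge.
Variables (V : finType) (G F : sgraph V).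
Implicit Types (D : rel V) (a b s t u v w x y z : V).
Hypothesis optF : optimal G F.
Hypothesis no_isolated : forall F1 v, optimal G F1 -> deg F1 v != 0.

Definition isolated_edge x x' : Prop :=
  (forall v, F x v = (v == x')) /\ (forall v, F x' v = (v == x)).

Lemma isolated_edgeC x x' : isolated_edge x x' -> isolated_edge x' x.
Proof. by case. Qed.

Lemma isolated_edge_deg x x' : isolated_edge x x' -> deg F x = 1.
Proof.
by case=> Fx _; rewrite -(cards1 x'); apply: eq_card => v; rewrite !inE Fx.
Qed.

Lemma isolated_edge_deficient x x' : isolated_edge x x' -> deficient F x.
Proof. by rewrite /deficient => /isolated_edge_deg->. Qed.

Definition other_nbrs x x' := [set y | G x y && (y != x')].

Lemma other_nbrs_new x x' y : isolated_edge x x' ->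
  y \in other_nbrs x x' -> G x y /\ ~~ F x y.
Proof. by case=> Fx _; rewrite inE Fx => /andP[]. Qed.

Lemma other_nbrs_neq x x' y : y \in other_nbrs x x' -> y != x /\ y != x'.
Proof. by rewrite inE => /andP[Gxy ->]; rewrite eq_sym (adj_neq Gxy). Qed.

Lemma nbr_neq x x' w v : isolated_edge x x' -> F w v -> w != x -> v != x'.
Proof. by case=> _ Fx' Fwv; apply: contraNneq => ev; rewrite -Fx' adj_sym -ev. Qed.

Lemma other_nbrs_saturated x x' y :
  isolated_edge x x' -> y \in other_nbrs x x' -> ~~ deficient F y.
Proof.
move=> le yS; have [Gxy nFxy] := other_nbrs_new le yS; apply/negP => dy.
exact: (deficient_nonadjacent optF (isolated_edge_deficient le) dy Gxy nFxy).
Qed.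

Section Ends.
Variables x x' : V.
Hypothesis le : isolated_edge x x'.

Let Fxx' : F x x'. Proof. by rewrite le.1. Qed.
Let dx : deficient F x := isolated_edge_deficient le.
Let dx' : deficient F x' := isolated_edge_deficient (isolated_edgeC le).
Let xx' : x != x' := adj_neq Fxx'.
Let x'x : x' != x. Proof. by rewrite eq_sym. Qed.

Lemma end_neq y t : y \in other_nbrs x x' -> F y t -> t != x /\ t != x'.
Proof.
move=> /other_nbrs_neq[yx yx'] Fyt.
by split; [apply: (nbr_neq (isolated_edgeC le) Fyt) | apply: (nbr_neq le Fyt)].
Qed.

(** Otherwise the trail [x y t x'] would be augmenting. *)
Lemma end_nonadjacent_far y t : y \in other_nbrs x x' -> F y t -> ~~ G x' t.
Proof.
move=> yS Fyt; apply/negP => Gx't; have [Gxy nFxy] := other_nbrs_new le yS.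
have [tx tx'] := end_neq yS Fyt; have [yx yx'] := other_nbrs_neq yS.
have [o1 d1 k1] := slide_step optF dx Gxy nFxy Fyt.
apply: (deficient_nonadjacent o1 (k1 _ x'x dx') d1 Gx't).
by apply: slide_avoids; [rewrite eq_sym | rewrite le.2 | off_edge].
Qed.

(** Otherwise the trail [x y t x x'] would isolate [x']. *)
Lemma end_nonadjacent_near y t : y \in other_nbrs x x' -> F y t -> ~~ G x t.
Proof.
move=> yS Fyt; apply/negP => Gxt; have [Gxy nFxy] := other_nbrs_new le yS.
have [tx tx'] := end_neq yS Fyt.
have nFxt : ~~ F x t by rewrite le.1.
have [F' [optF' deg'] _] := triangle_swap optF dx Fxx' Gxy nFxy Fyt Gxt nFxt.
have := no_isolated x' optF'; rewrite -lt0n.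
by move: deg'; rewrite (isolated_edge_deg (isolated_edgeC le)); case: (deg F' x').
Qed.

Lemma end_not_near y t : y \in other_nbrs x x' -> F y t ->
  t \notin other_nbrs x x'.
Proof.
by move=> yS /(end_nonadjacent_near yS); apply: contraNN; rewrite inE => /andP[].
Qed.

Lemma end_not_far y t : y \in other_nbrs x x' -> F y t ->
  t \notin other_nbrs x' x.
Proof.
by move=> yS /(end_nonadjacent_far yS); apply: contraNN; rewrite inE => /andP[].
Qed.

(** Otherwise the trail [x y t s z x x'] would isolate [x']. *)
Lemma ends_nonadjacent_same y z t s :
  y \in other_nbrs x x' -> z \in other_nbrs x x' -> y != z ->
  F y t -> F z s -> ~~ F t s -> ~~ G t s.
Proof.
move=> yS zS yz Fyt Fzs nFts; apply/negP => Gts.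
have [Gxy nFxy] := other_nbrs_new le yS.
have [Gxz nFxz] := other_nbrs_new le zS.
have tS := end_not_near yS Fyt; have sS := end_not_near zS Fzs.
have tz : t != z by apply: contraNneq tS => ->.
have sy : s != y by apply: contraNneq sS => ->.
have x't : x' != t by rewrite eq_sym (end_neq yS Fyt).2.
have [F' [optF' deg'] _] :=
  pentagon_swap optF dx Fxx' Gxy nFxy Fyt Gxz nFxz Fzs Gts nFts yz tz sy x't.
have := no_isolated x' optF'; rewrite -lt0n.
by move: deg'; rewrite (isolated_edge_deg (isolated_edgeC le)); case: (deg F' x').
Qed.

(** Otherwise the trail [x y t s z x'] would be augmenting. *)
Lemma ends_nonadjacent_opposite y z t s :
  y \in other_nbrs x x' -> z \in other_nbrs x' x ->
  F y t -> F z s -> ~~ F t s -> ~~ G t s.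
Proof.
move=> yS zS Fyt Fzs nFts; apply/negP => Gts.
have [Gxy nFxy] := other_nbrs_new le yS.
have [Gx'z nFx'z] := other_nbrs_new (isolated_edgeC le) zS.
have [yx yx'] := other_nbrs_neq yS; have [zx' zx] := other_nbrs_neq zS.
have [tx tx'] := end_neq yS Fyt; have sx' := slide_end_neq nFx'z Fzs.
have sx : s != x by apply: (nbr_neq (isolated_edgeC le) Fzs).
have xy := adj_neq Gxy; have x'z := adj_neq Gx'z; have ts := adj_neq Gts.
have tS := end_not_far yS Fyt; have tz : t != z by apply: contraNneq tS => ->.
have x'xn := x'x.
have [o1 d1 k1] := slide_step optF dx Gxy nFxy Fyt.
have nF1 : ~~ slide F x y t x' z by apply: slide_avoids => //; off_edge.
have F1 : slide F x y t z s by apply: slide_keeps => //; off_edge.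
have [o2 d2 k2] := slide_step o1 (k1 _ x'x dx') Gx'z nF1 F1.
apply: (deficient_nonadjacent o2 (k2 _ tx' d1) d2 Gts).
apply: slide_avoids => //; last by off_edge.
by apply: slide_avoids => //; off_edge.
Qed.

End Ends.

Section SameNbrs.
Variables (x x' : V) (D : rel V).
Hypotheses (le : isolated_edge x x') (oD : orients D F).
Hypothesis hG : forall I v, independent G I -> v \in I -> #|I| <= deg G v.

Lemma other_nbrs_nxt x1 x2 y : isolated_edge x1 x2 ->
  y \in other_nbrs x1 x2 -> ~ sink D y.
Proof.
move=> le12 yS snk; have/negP := other_nbrs_saturated le12 yS; case.
exact: deg_sink oD snk.
Qed.

Lemma deg_other_nbrs : deg G x = #|other_nbrs x x'|.+1.
Proof.
rewrite /deg (cardsD1 x') inE optF.1.1 ?le.1 // add1n; congr _.+1.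
by apply: eq_card => v; rewrite !inE andbC.
Qed.

(** The vertex [x] and the successors of all neighbours of [x] and of [x'] other
    than [x] and [x'] form an independent set, of size at most [d(x)]. *)
Lemma other_nbrs_sub : other_nbrs x' x \subset other_nbrs x x'.
Proof.
set T := other_nbrs x x' :|: other_nbrs x' x.
have nsnk : {in T, forall y, ~ sink D y}.
  move=> y; rewrite inE => /orP[]; apply: other_nbrs_nxt => //.
  exact: isolated_edgeC.
have Fn y : y \in T -> F y (nxt D y).
  by move=> yT; apply: (orient_adj oD); apply: nxtP; apply: nsnk.
have le' := isolated_edgeC le.
have nT y t : y \in T -> F y t -> t \notin T /\ ~~ G x t.
  rewrite in_setU => /orP[] yT Fyt; rewrite in_setU negb_or.
    rewrite (end_not_near le yT Fyt) (end_not_far le yT Fyt).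
    by split=> //; apply: end_nonadjacent_near le _ _ yT Fyt.
  rewrite (end_not_near le' yT Fyt) (end_not_far le' yT Fyt).
  by split=> //; apply: end_nonadjacent_far le' _ _ yT Fyt.
have nD y z : y \in T -> z \in T -> ~~ D (nxt D y) (nxt D z).
  move=> yT zT; apply/negP => Dyz; have [+ _] := nT _ _ yT (Fn y yT).
  by rewrite (in_inj oD Dyz (nxtP (nsnk z zT))) zT.
have nG y z : y \in T -> z \in T -> ~~ G (nxt D y) (nxt D z).
  move=> yT zT; have nF : ~~ F (nxt D y) (nxt D z).
    by rewrite (orientE oD) negb_or !nD.
  have := Fn _ yT; have := Fn _ zT; case: (eqVneq y z) => [->|yz].
    by rewrite adj_irrefl.
  move: yT zT; rewrite !in_setU => /orP[]yT /orP[]zT Fz Fy.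
  - exact: (ends_nonadjacent_same le yT zT yz Fy Fz nF).
  - exact: (ends_nonadjacent_opposite le yT zT Fy Fz nF).
  - exact: (ends_nonadjacent_opposite le' yT zT Fy Fz nF).
  - exact: (ends_nonadjacent_same le' yT zT yz Fy Fz nF).
have indep : independent G (x |: nxt D @: T).
  move=> u v; rewrite in_setU1 => /orP[/eqP->|/imsetP[y yT ->]];
    rewrite in_setU1 => /orP[/eqP->|/imsetP[z zT ->]].
  - by rewrite adj_irrefl.
  - exact: (nT _ _ zT (Fn z zT)).2.
  - by rewrite adj_sym (nT _ _ yT (Fn y yT)).2.
  exact: nG.
have := hG indep (setU11 _ _); rewrite deg_other_nbrs cardsU1.
rewrite (card_nxt oD nsnk) (_ : x \notin _) /=; last first.
  apply/imsetP => -[y yT ex]; have Fy := Fn y yT; rewrite -ex in Fy.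
  move: yT; rewrite adj_sym le.1 in Fy; rewrite (eqP Fy) !inE eqxx adj_irrefl.
  by rewrite andbF.
rewrite add1n ltnS => leT.
have /eqP eT : other_nbrs x x' == T by rewrite eqEcard subsetUl.
by rewrite eT subsetUr.
Qed.

End SameNbrs.

Section Structure.
Variables x x' : V.
Hypothesis le : isolated_edge x x'.
Hypothesis hG : forall I v, independent G I -> v \in I -> #|I| <= deg G v.
Let S := other_nbrs x x'.
Hypothesis eqS : other_nbrs x' x = S.

Let le' : isolated_edge x' x := isolated_edgeC le.
Let Fxx' : F x x'. Proof. by rewrite le.1. Qed.
Let x'x : x' != x. Proof. by rewrite eq_sym (adj_neq Fxx'). Qed.
Let dx : deficient F x := isolated_edge_deficient le.
Let dx' : deficient F x' := isolated_edge_deficient le'.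

Lemma new_x y : y \in S -> G x y /\ ~~ F x y.
Proof. exact: other_nbrs_new. Qed.

Lemma new_x' y : y \in S -> G x' y /\ ~~ F x' y.
Proof. by rewrite -eqS; apply: other_nbrs_new. Qed.

Lemma S_neq y : y \in S -> y != x /\ y != x'.
Proof. exact: other_nbrs_neq. Qed.

Lemma end_notin y t : y \in S -> F y t -> t \notin S.
Proof. exact: (end_not_near le). Qed.

(** Trails that leave [x] through [y] and [t], and go on through an edge [wv] of
    [F] with [w] not among [x], [x'] and the vertices of [S]. *)
Section FarNbr.
Variables y t w v : V.
Hypotheses (yS : y \in S) (Fyt : F y t) (Gtw : G t w) (nFtw : ~~ F t w).
Hypotheses (wS : w \notin S) (wx : w != x) (wx' : w != x') (Fwv : F w v).

Let wy : w != y. Proof. by apply: contraNneq wS => ->. Qed.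
Let ty : t != y. Proof. by rewrite eq_sym (adj_neq Fyt). Qed.
Let F1 := slide F x y t.
Let F2 := slide F1 t w v.

Lemma far_saturated : ~~ deficient F w.
Proof.
apply/negP => dw; have [Gxy nFxy] := new_x yS; have [tx _] := end_neq le yS Fyt.
have [o1 d1 k1] := slide_step optF dx Gxy nFxy Fyt.
apply: (deficient_nonadjacent o1 d1 (k1 _ wx dw) Gtw).
apply: slide_avoids; rewrite ?(adj_neq Gxy) //.
by off_edge.
Qed.

Lemma far_step : optimal G F2 /\ deficient F2 v /\ deficient F2 x'.
Proof.
have [Gxy nFxy] := new_x yS; have [tx tx'] := end_neq le yS Fyt.
have [o1 d1 k1] := slide_step optF dx Gxy nFxy Fyt.
have nF1 : ~~ F1 t w.
  apply: slide_avoids; rewrite ?(adj_neq Gxy) //.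
  by off_edge.
have F1wv : F1 w v.
  apply: slide_keeps; rewrite ?(adj_neq Gxy) //.
  by off_edge.
have [o2 d2 k2] := slide_step o1 d1 Gtw nF1 F1wv.
by split=> //; split=> //; apply: k2; [rewrite eq_sym | apply: k1].
Qed.

Lemma far_avoids a b : ~~ F a b -> ~~ joins x y a b -> ~~ joins t w a b ->
  ~~ F2 a b.
Proof.
have [Gxy _] := new_x yS => nFab j1 j2.
apply: slide_avoids => //; first exact: adj_neq Gtw.
by apply: slide_avoids => //; apply: adj_neq Gxy.
Qed.

Lemma far_keeps a b : F a b -> ~~ joins y t a b -> ~~ joins w v a b -> F2 a b.
Proof.
have [Gxy _] := new_x yS => Fab j1 j2.
apply: slide_keeps => //; first exact: adj_neq Gtw.
by apply: slide_keeps => //; apply: adj_neq Gxy.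
Qed.

(** Otherwise the trail [x y t w v x'] would be augmenting. *)
Lemma far_notin : v \notin S.
Proof.
apply/negP => vS; have [o2 [dv dx'2]] := far_step.
have [Gx'v nFx'v] := new_x' vS.
apply: (deficient_nonadjacent o2 dx'2 dv Gx'v).
have [_ tx'] := end_neq le yS Fyt; have [_ yx'] := S_neq yS.
by apply: far_avoids => //; off_edge.
Qed.

Let vS : v \notin S := far_notin.

(** Otherwise the trail [x y t w v s z x'] would be augmenting. *)
Lemma far_nonadjacent z s : z \in S -> F z s -> ~~ joins y t z s ->
  s != w -> ~~ F v s -> ~~ G v s.
Proof.
move=> zS Fzs njoin sw nFvs; apply/negP => Gvs.
have [o2 [dv dx'2]] := far_step.
have [Gx'z nFx'z] := new_x' zS.
have [tx tx'] := end_neq le yS Fyt; have [yx yx'] := S_neq yS.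
have [sx sx'] := end_neq le zS Fzs; have [zx zx'] := S_neq zS.
have wz : w != z by apply: contraNneq wS => ->.
have vz : v != z by apply: contraNneq vS => ->.
have vx' : v != x' by apply: (nbr_neq le Fwv).
have vx : v != x by apply: (nbr_neq le' Fwv).
have vt : v != t by apply: contraNneq nFtw => <-; rewrite adj_sym.
have x'xn := x'x; have wxn := wx; have wxn' := wx'.
have vs := adj_neq Gvs; have wv := adj_neq Fwv.
have nF2 : ~~ F2 x' z.
  apply: far_avoids => //.
    by off_edge.
  by off_edge.
have F2zs : F2 z s.
  by apply: far_keeps => //; off_edge.
have [o3 d3 k3] := slide_step o2 dx'2 Gx'z nF2 F2zs.
apply: (deficient_nonadjacent o3 (k3 _ vx' dv) d3 Gvs).
apply: slide_avoids; [exact: adj_neq Gx'z | | ].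
  apply: far_avoids => //.
    by off_edge.
  by off_edge.
by off_edge.
Qed.

(** Here [t] is the common F-neighbour of [y] and [z], and the trail is
    [x y t w v t z x']: it joins [x] to [y] and [x'] to [z], and moves [t] into
    the edge [wv]. *)
Lemma far_common_end z : z \in S -> F z t -> z != y -> G t v -> F t v.
Proof.
move=> zS Fzt zy Gtv; apply/idPn => nFtv.
have [o2 [dv dx'2]] := far_step.
have [Gx'z nFx'z] := new_x' zS.
have [tx tx'] := end_neq le yS Fyt; have [yx yx'] := S_neq yS.
have [zx zx'] := S_neq zS.
have wz : w != z by apply: contraNneq wS => ->.
have vz : v != z by apply: contraNneq vS => ->.
have vx' : v != x' by apply: (nbr_neq le Fwv).
have vx : v != x by apply: (nbr_neq le' Fwv).
have x'xn := x'x; have tyn := ty; have tv := adj_neq Gtv.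
have tz : t != z by rewrite eq_sym (adj_neq Fzt).
have wv := adj_neq Fwv; have wxn' := wx'; have tw := adj_neq Gtw.
have nF2 : ~~ F2 x' z.
  apply: far_avoids => //.
    by off_edge.
  by off_edge.
have F2zt : F2 z t.
  apply: far_keeps => //.
    by off_edge.
  by off_edge.
have [o3 d3 k3] := slide_step o2 dx'2 Gx'z nF2 F2zt.
apply: (deficient_nonadjacent o3 d3 (k3 _ vx' dv) Gtv).
apply: slide_avoids; [exact: adj_neq Gx'z | | ].
  apply: far_avoids => //.
    by off_edge.
  by off_edge.
by off_edge.
Qed.

End FarNbr.

Definition shifted D := x |: nxt D @: S.

Section Oriented.
Variable D : rel V.
Hypothesis oD : orients D F.

Lemma S_arc y : y \in S -> D y (nxt D y).
Proof. by move=> yS; apply: nxtP; apply: (other_nbrs_nxt oD le yS). Qed.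

Lemma S_edge y : y \in S -> F y (nxt D y).
Proof. by move/S_arc/(orient_adj oD). Qed.

Lemma pred_eq y a : y \in S -> D a (nxt D y) -> a = y.
Proof. by move=> yS Da; apply: (in_inj oD Da (S_arc yS)). Qed.

Lemma shiftedP v :
  reflect (v = x \/ exists2 y, y \in S & v = nxt D y) (v \in shifted D).
Proof.
rewrite in_setU1; apply: (iffP orP) => [[/eqP|/imsetP[y]]|[->|[y yS ->]]].
- by left.
- by right; exists y.
- by left.
by right; apply: imset_f.
Qed.

Lemma nxt_shifted y : y \in S -> nxt D y \in shifted D.
Proof. by move=> yS; apply/shiftedP; right; exists y. Qed.

Lemma shifted_not_S v : v \in shifted D -> v \notin S.
Proof.
case/shiftedP => [->|[y yS ->]]; first by rewrite inE adj_irrefl.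
exact: end_notin (S_edge yS).
Qed.

Lemma S_shifted_independent : independent G (shifted D).
Proof.
have nD y z : y \in S -> z \in S -> ~~ D (nxt D y) (nxt D z).
  move=> yS zS; apply/negP => /(pred_eq zS) ez.
  by have := end_notin yS (S_edge yS); rewrite ez zS.
move=> u v /shiftedP[->|[y yS ->]] /shiftedP[->|[z zS ->]].
- by rewrite adj_irrefl.
- exact: (end_nonadjacent_near le zS (S_edge zS)).
- by rewrite adj_sym; apply: (end_nonadjacent_near le yS (S_edge yS)).
case: (eqVneq y z) => [->|yz]; first by rewrite adj_irrefl.
apply: (ends_nonadjacent_same le yS zS yz (S_edge yS) (S_edge zS)).
by rewrite (orientE oD) negb_or !nD.
Qed.

Lemma card_S_shifted : #|shifted D| = #|S|.+1.
Proof.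
rewrite cardsU1 (card_nxt oD) => [|y yS]; last exact: (other_nbrs_nxt oD le yS).
suff -> : x \notin nxt D @: S by [].
apply/imsetP => -[y yS ex]; have [tx _] := end_neq le yS (S_edge yS).
by rewrite -ex eqxx in tx.
Qed.

(** The independent set [shifted D] already has [d(x)] elements. *)
Lemma shifted_dominates v : v \notin S -> v != x' -> v \notin shifted D ->
  exists2 y, y \in S & G v (nxt D y).
Proof.
move=> vS vx' vI; apply: NNPP => noy.
have nG u : u \in shifted D -> ~~ G v u.
  case/shiftedP => [->|[y yS ->]]; apply/negP => Gv.
    by case/negP: vS; rewrite inE adj_sym Gv.
  by apply: noy; exists y.
have indep : independent G (v |: shifted D).
  move=> a b; rewrite in_setU1 => /orP[/eqP->|aI];
    rewrite in_setU1 => /orP[/eqP->|bI].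
  - by rewrite adj_irrefl.
  - exact: nG.
  - by rewrite adj_sym; apply: nG.
  exact: S_shifted_independent.
have xI : x \in v |: shifted D by rewrite !inE eqxx orbT.
have := hG indep xI.
by rewrite (deg_other_nbrs le) cardsU1 vI card_S_shifted ltnn.
Qed.

(** The configuration that the join structure of [G] forbids: a neighbour [w] of
    the successor of [y], joined to it by an edge outside [F], that is none of
    the vertices known so far. *)
Definition far y w := [/\ w \notin S, w \notin shifted D, w != x',
  G w (nxt D y) & ~~ F w (nxt D y)].

(** The successor [v] of [w] has a neighbour [nxt D z] in [shifted D]. The edge
    between them is not in [F], as [D] is an orientation, so
    [far_nonadjacent] leaves only [z = y]. *)
Lemma far_succ y w : y \in S -> far y w -> exists2 v, D w v & far y v.
Proof.
move=> yS [wS wI wx' Gwt nFwt]; have Fyt := S_edge yS.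
have wx : w != x by apply: contraNneq wI => ->; rewrite setU11.
have Gtw : G (nxt D y) w by rewrite adj_sym.
have nFtw : ~~ F (nxt D y) w by rewrite adj_sym.
have [snk|[v Dwv]] := sink_or_not D w.
  have /negP := far_saturated yS Fyt Gtw nFtw wx.
  by case; apply: deg_sink oD snk.
have Fwv := orient_adj oD Dwv; exists v => //.
have vS := far_notin yS Fyt Gtw nFtw wS wx' Fwv.
have vx' := nbr_neq le Fwv wx.
have vI : v \notin shifted D.
  apply/negP => /shiftedP[ev|[z zS ev]].
    by have := nbr_neq le' Fwv wx'; rewrite ev eqxx.
  by rewrite ev in Dwv; rewrite (pred_eq zS Dwv) zS in wS.
have [z zS Gvs] := shifted_dominates vS vx' vI.
have Fzs := S_edge zS.
have nFvs : ~~ F v (nxt D z).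
  rewrite (orientE oD) negb_or; apply/andP; split; apply/negP => Dv.
    by rewrite (pred_eq zS Dv) zS in vS.
  by rewrite (in_inj oD Dwv Dv) nxt_shifted in wI.
case: (eqVneq z y) => [ez|zy]; first by rewrite -ez.
have sw : nxt D z != w by apply: contraNneq wI => <-; apply: nxt_shifted.
have zt : z != nxt D y.
  by apply: contraTneq zS => ->; apply: end_notin Fyt.
have njoin : ~~ joins y (nxt D y) z (nxt D z) by off_edge.
have/negP := far_nonadjacent yS Fyt Gtw nFtw wS wx wx' Fwv zS Fzs njoin sw nFvs.
by case.
Qed.

End Oriented.

(** The vertex [w] is adjacent to the predecessor [s] of some [z] in [S], as the
    reversed orientation shows, and the two successors of [w] are far as well.
    The trail [x y t v w s z x'], with [v] the successor of [w], is
    augmenting, or [s = t] and [far_common_end] applies. *)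
Lemma far_empty D y w : orients D F -> y \in S -> ~ far D y w.
Proof.
move=> oD yS farw; have oR := orients_reverse oD.
have [v Dwv farv] := far_succ oD yS farw.
have [u Dvu [uS _ _ _ _]] := far_succ oD yS farv.
case: farw => wS wI wx' Gwt nFwt; case: farv => vS vI vx' Gvt nFvt.
have wx : w != x by apply: contraNneq wI => ->; rewrite setU11.
have vx : v != x by apply: contraNneq vI => ->; rewrite setU11.
have wR : w \notin shifted (reverse D).
  apply/negP => /shiftedP[ew|[z zS ew]]; first by rewrite ew eqxx in wx.
  have := S_arc oR zS; rewrite -ew /reverse => Dwz.
  by rewrite (out_inj oD Dwv Dwz) zS in vS.
have [z zS] := shifted_dominates oR wS wx' wR.
set s := nxt (reverse D) z => Gws.
have Dsz : D s z := S_arc oR zS.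
have Fzs : F z s := S_edge oR zS.
have nFws : ~~ F w s.
  rewrite (orientE oD) negb_or; apply/andP; split; apply/negP => Ds.
    rewrite -(out_inj oD Dwv Ds) in Dsz.
    by rewrite (out_inj oD Dvu Dsz) zS in uS.
  by rewrite (out_inj oD Ds Dsz) zS in wS.
have Dyt := S_arc oD yS; have Fyt := S_edge oD yS.
set t := nxt D y in Gwt nFwt Gvt nFvt Dyt Fyt.
have Gtv : G t v by rewrite adj_sym.
have nFtv : ~~ F t v by rewrite adj_sym.
have Fvw : F v w by apply: (orient_adjV oD Dwv).
have Gtw : G t w by rewrite adj_sym.
have nFtw : ~~ F t w by rewrite adj_sym.
case: (eqVneq s t) => [est|st].
  rewrite est in Fzs Dsz.
  have zy : z != y by apply: contraTneq Dsz => ->; apply: (orient_asym oD Dyt).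
  have := far_common_end yS Fyt Gtv nFtv vS vx vx' Fvw zS Fzs zy Gtw.
  by rewrite (negPf nFtw).
have zt : z != t by apply: contraTneq zS => ->; apply: end_notin Fyt.
have njoin : ~~ joins y t z s by off_edge.
have sv : s != v.
  apply: contraNneq uS => sv; rewrite sv in Dsz.
  by rewrite (out_inj oD Dvu Dsz).
have/negP := far_nonadjacent yS Fyt Gtv nFtv vS vx vx' Fvw zS Fzs njoin sv nFws.
by case.
Qed.

Section SecondSuccessor.
Variable D : rel V.
Hypothesis oD : orients D F.

Lemma outside_is_second_succ w : w \notin S -> w \notin shifted D -> w != x' ->
  exists2 y, y \in S & D (nxt D y) w.
Proof.
move=> wS wI wx'; have [y yS Gwt] := shifted_dominates oD wS wx' wI.
exists y => //; have Fwt : F w (nxt D y).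
  by apply/idPn => nFwt; apply: (far_empty oD yS); split; eassumption.
move: Fwt; rewrite (orientE oD) => /orP[Dw|//].
by rewrite (pred_eq oD yS Dw) yS in wS.
Qed.

(** The neighbours of [nxt D y] are confined to [S] and its successor, and
    it has at least [#|shifted D| = #|S| + 1] of them. *)
Lemma nbrs_succ y : y \in S -> exists b, [/\ D (nxt D y) b, b \notin S &
  forall w, G (nxt D y) w = (w == b) || (w \in S)].
Proof.
move=> yS; set a := nxt D y; have Fya := S_edge oD yS.
have aI := nxt_shifted D yS.
have subN w : G a w -> w \notin S -> D a w.
  move=> Gaw wS; have wx' : w != x'.
    apply: contraTneq Gaw => ->; rewrite adj_sym.
    exact: (end_nonadjacent_far le yS Fya).
  have wI : w \notin shifted D.
    by apply: contraTN Gaw; apply: (S_shifted_independent oD).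
  have nfar := @far_empty D y w oD yS.
  have Faw : F a w.
    by apply/idPn => nFaw; apply: nfar; split; rewrite // adj_sym.
  move: Faw; rewrite (orientE oD) => /orP[//|Dwa].
  by rewrite (pred_eq oD yS Dwa) yS in wS.
have dega : #|S| < deg G a.
  by rewrite -(card_S_shifted oD); apply: hG aI; apply: S_shifted_independent.
have [snk|[b Dab]] := sink_or_not D a.
  move: dega; rewrite ltnNge subset_leq_card //; apply/subsetP => w.
  rewrite inE => Gaw; apply/idPn => /(subN w Gaw).
  by rewrite (negPf (snk w)).
have subNb : [set w | G a w] \subset b |: S.
  apply/subsetP => w; rewrite !inE => Gaw; case: (boolP (w \in S)) => [wS|wS].
    by move: wS; rewrite inE => ->; rewrite orbT.
  by rewrite (out_inj oD (subN w Gaw wS) Dab) eqxx.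
have leNb := subset_leq_card subNb.
have bS : b \notin S.
  by apply/negP => bS; move: leNb; rewrite cardsU1 bS leqNgt dega.
have /eqP eN : [set w | G a w] == b |: S.
  by rewrite eqEcard subNb cardsU1 bS.
exists b; split=> // w; have := in_setU1 w b S.
by rewrite -eN inE.
Qed.

End SecondSuccessor.

(** Once [b] is the predecessor of some [z] in [S], this is [nbrs_succ] for the
    reversed orientation. Otherwise the successor [c] of [b] would precede
    such a [z], and [c] has no place in the forward orientation. *)
Lemma nbrs_succ2 D y b : orients D F -> y \in S -> D (nxt D y) b ->
  forall w, G b w = (w == nxt D y) || (w \in S).
Proof.
move=> oD yS Dab; have oR := orients_reverse oD.
have Fya := S_edge oD yS; have [ax ax'] := end_neq le yS Fya.
have aS := end_notin yS Fya.
set a := nxt D y in Dab Fya ax ax' aS *; have Fab := orient_adj oD Dab.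
have bx := nbr_neq le' Fab ax'; have bx' := nbr_neq le Fab ax.
have [b' [Dab' bS _]] := nbrs_succ oD yS.
rewrite -(out_inj oD Dab Dab') in bS => {b' Dab'}.
have bR : b \in shifted (reverse D).
  apply/idPn => bR; have [z zS] := outside_is_second_succ oR bS bR bx'.
  rewrite /reverse; set c := nxt _ z => Dbc.
  have Fbc := orient_adj oD Dbc.
  have cS : c \notin S by apply: end_notin zS (S_edge oR zS).
  have cI : c \notin shifted D.
    apply/negP => /shiftedP[ec|[u uS ec]].
      by have := nbr_neq le' Fbc bx'; rewrite ec eqxx.
    by rewrite ec in Dbc; rewrite (pred_eq oD uS Dbc) uS in bS.
  have [u uS Duc] := outside_is_second_succ oD cS cI (nbr_neq le Fbc bx).
  have eb := in_inj oD Dbc Duc; rewrite eb in Dab.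
  by rewrite (pred_eq oD uS Dab) uS in aS.
case/shiftedP: bR => [eb|[z zS eb]]; first by rewrite eb eqxx in bx.
have [a' [Da' _ Gb]] := nbrs_succ oR zS; rewrite -eb in Da' Gb.
by move=> w; rewrite Gb (in_inj oD Da' Dab).
Qed.

End Structure.
End LonelyEdge.

(** * Recognising the exceptional graphs *)

Section Recognition.
Variables (V : finType) (G : sgraph V) (S I : {set V}) (m : V -> V).
Hypothesis IS : {in I, forall i, i \notin S}.
Hypothesis mS : {in I, forall i, m i \notin S}.
Hypothesis mI : {in I, forall i, m i \notin I}.
Hypothesis GI : {in I, forall i v, G i v = (v == m i) || (v \in S)}.
Hypothesis Gm : {in I, forall i v, G (m i) v = (v == i) || (v \in S)}.
Hypothesis VE : forall v, [\/ v \in S, v \in I | exists2 i, i \in I & v = m i].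
Hypothesis cardI : #|I| = #|S|.+1.

Let W := {v : V | v \in S}.

Definition induced_rel : rel W := fun a b => G (val a) (val b).

Fact induced_sym : symmetric induced_rel.
Proof. by move=> a b; apply: adj_sym. Qed.

Fact induced_irrefl : irreflexive induced_rel.
Proof. by move=> a; apply: adj_irrefl. Qed.

Let H := SGraph induced_sym induced_irrefl.
Let K := join H (copies #|I| (complete 2)).

Let g (c : W + 'I_#|I| * 'I_2) : V :=
  match c with
  | inl s => val s
  | inr (i, j) => if j == ord0 then enum_val i else m (enum_val i)
  end.

Let eI (i : 'I_#|I|) : enum_val i \in I. Proof. exact: enum_valP. Qed.

Lemma partner_inj : {in I &, injective m}.
Proof.
move=> i j iI jI em; have: G (m j) i by rewrite -em Gm // eqxx.
by rewrite Gm // (negPf (IS iI)) orbF => /eqP.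
Qed.

Lemma two_cases (j : 'I_2) : j = ord0 \/ j = ord_max.
Proof. by case: j => [[|[|//]] ltj]; [left | right]; apply: val_inj. Qed.

Let g_inj : injective g.
Proof.
have notS i j : g (inr (i, j)) \notin S.
  by rewrite /g; case: ifP => _; [apply: IS | apply: mS].
move=> [s|[i j]] [s'|[i' j']] /=.
- by move/val_inj->.
- by move=> e; have := notS i' j'; rewrite /= -e (valP s).
- by move=> e; have := notS i j; rewrite /= e (valP s').
case: (two_cases j) => ->; case: (two_cases j') => -> /=.
- by move/enum_val_inj->.
- by move=> e; have := mI (eI i'); rewrite -e eI.
- by move=> e; have := mI (eI i); rewrite e eI.
by move/(partner_inj (eI i) (eI i'))/enum_val_inj->.
Qed.

Let g_surj v : exists c, g c == v.
Proof.
case: (VE v) => [vS|vI|[i iI ->]].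
- by exists (inl (exist _ v vS)).
- by exists (inr (enum_rank_in vI v, ord0)); rewrite /= enum_rankK_in.
by exists (inr (enum_rank_in iI i, ord_max)); rewrite /= enum_rankK_in.
Qed.

Let g_adj c d : G (g c) (g d) = K c d.
Proof.
case: c d => [s|[i j]] [s'|[i' j']] //=.
- rewrite adj_sym; case: ifP => _; rewrite ?Gm ?GI //;
    by rewrite (svalP s) orbT.
- by case: ifP => _; rewrite ?Gm ?GI // (svalP s') orbT.
rewrite /copies_rel /= /complete_rel.
case: (two_cases j) => ->; case: (two_cases j') => -> /=;
  rewrite ?Gm ?GI // ?(negPf (IS (eI _))) ?(negPf (mS (eI _))) ?orbF.
- rewrite andbF; apply: contraTF (eI i') => /eqP->; exact: mI.
- rewrite andbT eq_sym.
  by apply/eqP/eqP => [/(partner_inj (eI i) (eI i'))/enum_val_inj|->].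
- by rewrite andbT (inj_eq enum_val_inj) eq_sym.
rewrite andbF; apply: contraNF (mI (eI i')) => /eqP->; exact: eI.
Qed.

(** The map [g] sends the copy of [K_2] with index [i] to the [i]-th element of
    [I] and its partner under [m]. *)
Lemma classG_recognition :
  exists (X : finType) (F : sgraph X), classG F /\ isomorphic G F.
Proof.
exists (W + 'I_#|I| * 'I_2)%type, K; split.
  exists #|I|; split; first by rewrite cardI.
  by apply: ClassGAt; rewrite cardI subn1 card_sig.
have [f gf] := fin_all_exists g_surj.
have fK : cancel f g by move=> v; apply/eqP.
have gK : cancel g f by move=> c; apply: g_inj; rewrite fK.
exists f; split; first by exists g.
by move=> u v; rewrite -g_adj !fK.
Qed.

End Recognition.

Theorem theorem4 (V : finType) (G : sgraph V)
    (hG : forall I : {set V}, I != set0 -> independent G I ->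
            #|I| <= min_deg G I) :
  has_2factor G \/
  exists (W : finType) (F : sgraph W), classG F /\ isomorphic G F.
Proof.
have min_deg_le (I : {set V}) v : v \in I -> min_deg G I <= deg G v.
  rewrite /min_deg => vI; move: (mem_index_enum v).
  elim: index_enum => //= w r IHr; rewrite inE big_cons => /orP[/eqP<-|/IHr le_r].
    by rewrite vI geq_minl.
  by case: ifP => // _; apply: leq_trans (geq_minr _ _) le_r.
have {}hG (I : {set V}) v : independent G I -> v \in I -> #|I| <= deg G v.
  move=> indI vI; apply: leq_trans (min_deg_le I v vI).
  by apply: hG => //; apply/set0Pn; exists v.
case: (classic (has_2factor G)) => [|no2]; [by left | right].
have [F [x0 [x0' [optF Fx0 Fx0' noiso]]]] := deficient_edge hG no2.
have [D oD] := orientation_exists optF.1.2.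
have [x [x' [le Dxx']]] : exists x x', isolated_edge F x x' /\ D x x'.
  have : F x0 x0' by rewrite Fx0.
  rewrite (orientE oD) => /orP[Dx|Dx]; first by exists x0, x0'.
  by exists x0', x0.
have le' := isolated_edgeC le.
have eqS : other_nbrs G x' x = other_nbrs G x x'.
  apply/eqP; rewrite eqEsubset (other_nbrs_sub optF noiso le oD hG).
  exact: (other_nbrs_sub optF noiso le' oD hG).
set S := other_nbrs G x x'; set I := shifted G x x' D.
have nxt_x : nxt D x = x'.
  apply: (out_inj oD _ Dxx'); apply: nxtP => snk.
  by rewrite (negPf (snk x')) in Dxx'.
have Gx v : G x v = (v == x') || (v \in S).
  rewrite inE; case: (eqVneq v x') => [->|_]; last by rewrite andbT.
  by rewrite /= (optF.1.1 x x') // le.1.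
have Gx' v : G x' v = (v == x) || (v \in S).
  rewrite /S -eqS inE; case: (eqVneq v x) => [->|_]; last by rewrite andbT.
  by rewrite /= (optF.1.1 x' x) // le.2.
have x'S : x' \notin S by rewrite inE eqxx andbF.
have x'x : x' != x.
  by rewrite eq_sym (adj_neq (orient_adj oD Dxx')).
have IS v : v \in I -> v \notin S by apply: (shifted_not_S optF noiso le oD).
have nbrs y : y \in S -> [/\ D (nxt D y) (nxt D (nxt D y)),
    nxt D (nxt D y) \notin S &
    forall w, G (nxt D y) w = (w == nxt D (nxt D y)) || (w \in S)].
  move=> yS; have [b [Db bS Ga]] := nbrs_succ optF noiso le hG eqS oD yS.
  suff -> : nxt D (nxt D y) = b by [].
  apply: (out_inj oD _ Db); apply: nxtP => snk.
  by rewrite (negPf (snk b)) in Db.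
have ends y : y \in S -> D y (nxt D y) /\ (nxt D y != x /\ nxt D y != x').
  move=> yS; have Dy := S_arc optF le oD yS; split=> //.
  exact: (end_neq le yS (orient_adj oD Dy)).
apply: (@classG_recognition V G S I (nxt D)).
- exact: IS.
- by move=> i /shiftedP[->|[y yS ->]]; rewrite ?nxt_x //; have [] := nbrs y yS.
- move=> i /shiftedP[->|[y yS ->]]; apply/negP => /shiftedP[|[z zS]].
  + by rewrite nxt_x => e; rewrite e eqxx in x'x.
  + by rewrite nxt_x => e; have [_ [_]] := ends z zS; rewrite -e eqxx.
  + move=> e; have [Da _ _] := nbrs y yS; have [_ [_ ax']] := ends y yS.
    have := orient_adjV oD Da; rewrite e le.1 => /eqP ea.
    by rewrite ea eqxx in ax'.
  move=> e; have [Da _ _] := nbrs y yS; rewrite e in Da.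
  have := in_inj oD Da (ends z zS).1 => ea.
  have := IS (nxt D y) (nxt_shifted D yS).
  by rewrite ea zS.
- move=> i /shiftedP[->|[y yS ->]] v; rewrite ?nxt_x //.
  by have [_ _ ->] := nbrs y yS.
- move=> i /shiftedP[->|[y yS ->]] v; rewrite ?nxt_x //.
  have [Da _ _] := nbrs y yS.
  exact: (nbrs_succ2 optF noiso le hG eqS oD yS Da).
- move=> v; case: (boolP (v \in S)) => [|vS]; first by constructor 1.
  case: (boolP (v \in I)) => [|vI]; first by constructor 2.
  constructor 3; case: (eqVneq v x') => [->|vx'].
    by exists x => //; apply: setU11.
  have [y yS Da] := outside_is_second_succ optF noiso le hG eqS oD vS vI vx'.
  exists (nxt D y); first exact: nxt_shifted.
  have [Da' _ _] := nbrs y yS; exact: (out_inj oD Da Da').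
exact: (card_S_shifted optF le oD).
Qed.
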